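(* Let $A$ be a real $n\times n$ matrix different from the zero matrix (possibly singular), let $F:\mathbb{R}^n\to\mathbb{R}^n$ be a $C^1$-mapping, and consider $\mathbb{R}^n$ with the Euclidean norm $\|\cdot\|$. Assume that: (i) either there exists a constant $0<a<\delta_{\min}(A)$ such that $\|F(x)\|\le a\|x\|$ for all $x\in\mathbb{R}^n$ with sufficiently large norm, or else there exists a constant $b>\delta_{\max}(A)$ such that $\|F(x)\|\ge b\|x\|$ for all $x\in\mathbb{R}^n$ with sufficiently large norm; (ii) $\det(A-F'(x))\ne 0$ for every $x\in\mathbb{R}^n$. Then for any $\xi\in\mathbb{R}^n$ the equation $Ax=F(x)+\xi$ has exactly one solution $x\in\mathbb{R}^n$.
   Context: $\delta_{\min}(A)$ and $\delta_{\max}(A)$ denote the smallest and the greatest singular value of $A$, i.e. the square roots of the smallest and greatest eigenvalue of $A^{T}A$. *)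

(* Defs.v *)
From HB Require Import structures.
From mathcomp Require Import all_boot all_order all_algebra.
From mathcomp Require Import all_classical all_reals all_analysis.

Set Implicit Arguments.
Unset Strict Implicit.
Unset Printing Implicit Defensive.

Import Order.TTheory GRing.Theory Num.Theory.
Import numFieldNormedType.Exports.

Local Open Scope classical_set_scope.
Local Open Scope ring_scope.

(* The library norm `|x| on matrices is the sup norm, so the Euclidean norm is
   defined separately; both induce the same topology and hence the same notions
   of differentiability and continuity. *)
Definition enorm (R : realType) (n : nat) (x : 'cV[R]_n) : R :=
  Num.sqrt (\sum_(i < n) x i 0 ^+ 2).

(* The library's Jacobian 'J is for maps between row vectors and acts on the
   right; here (jac F x) i j = d F_i / d x_j. *)
Definition jac (R : realType) (n : nat) (F : 'cV[R]_n -> 'cV[R]_n)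
    (x : 'cV[R]_n) : 'M[R]_n :=
  \matrix_(i < n, j < n) ('d F x : 'cV[R]_n -> 'cV[R]_n) (delta_mx j 0) i 0.

Definition C1_map (R : realType) (n : nat) (F : 'cV[R]_n -> 'cV[R]_n) : Prop :=
  (forall x, differentiable F x) /\ continuous (jac F).

(* For symmetric M and n > 0 the set of (real) eigenvalues is finite and
   nonempty, so the extremal eigenvalues exist; otherwise [get] may return an
   arbitrary value. *)
Definition smallest_eigenvalue (R : realType) (n : nat) (M : 'M[R]_n) : R :=
  get [set l : R | eigenvalue M l /\ forall m : R, eigenvalue M m -> l <= m].

Definition greatest_eigenvalue (R : realType) (n : nat) (M : 'M[R]_n) : R :=
  get [set l : R | eigenvalue M l /\ forall m : R, eigenvalue M m -> m <= l].

Definition delta_min (R : realType) (n : nat) (A : 'M[R]_n) : R :=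
  Num.sqrt (smallest_eigenvalue (A^T *m A)).

Definition delta_max (R : realType) (n : nat) (A : 'M[R]_n) : R :=
  Num.sqrt (greatest_eigenvalue (A^T *m A)).

(* Main.v *)
(** Put [G x = A x - F x]. Comparing [F] with [delta_min A] or [delta_max A]
    gives [|G x| >= k |x|] for large [x], so [G] is proper, and its Jacobian is
    everywhere invertible; such a map is bijective (Hadamard).
    Surjectivity: [|G x - y|] has a minimum, where a Newton step would decrease
    it unless [G x = y].
    Injectivity: if [G x1 = G x2 = y], contract the image of the segment from
    [x1] to [x2] radially to [y] and lift this homotopy through [G], keeping the
    end points. The final lifts form a path from [x1] to [x2] in a fibre of
    [G], which is discrete, so [x1 = x2]. The lifting relies on [G] mapping
    nearby points of a compact set to points at distance at least a uniform
    multiple of the original one. *)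

Require Import Defs.
From HB Require Import structures.
From mathcomp Require Import all_boot all_order all_algebra.
From mathcomp Require Import all_classical all_reals all_analysis.
From mathcomp Require Import ring lra.

Set Implicit Arguments.
Unset Strict Implicit.
Unset Printing Implicit Defensive.

Import Order.TTheory GRing.Theory Num.Theory.
Import numFieldNormedType.Exports.

Local Open Scope classical_set_scope.
Local Open Scope ring_scope.

(** * The sup norm on matrices: bounds, continuity, compactness *)

Lemma mx_norm_leP (R : realType) m n (M : 'M[R]_(m, n)) c : 0 <= c ->
  reflect (forall i j, `|M i j| <= c) (`|M| <= c).
Proof.
move=> c0; rewrite [leLHS]/Num.norm/= mx_normrE; apply: (iffP idP) => [|Mc].
  by move=> /bigmax_leP[_ Mc] i j; exact: (Mc (i, j)).
by apply/bigmax_leP; split => // -[i j] _; exact: Mc.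
Qed.

Lemma le_mx_norm (R : realType) m n (M : 'M[R]_(m, n)) i j : `|M i j| <= `|M|.
Proof. by move: i j; apply/mx_norm_leP. Qed.

Lemma mx_norm_mulmx (R : realType) m n p (M : 'M[R]_(m, n)) (N : 'M[R]_(n, p)) :
  `|M *m N| <= n%:R * `|M| * `|N|.
Proof.
apply/mx_norm_leP; first by rewrite !mulr_ge0.
move=> i j; rewrite mxE (le_trans (ler_norm_sum _ _ _))//.
have -> : n%:R * `|M| * `|N| = \sum_(k < n) `|M| * `|N|.
  by rewrite sumr_const card_ord -mulrA mulr_natl.
apply: ler_sum => k _.
by rewrite normrM ler_pM// le_mx_norm.
Qed.

Lemma mx_norm_trmx (R : realType) m n (M : 'M[R]_(m, n)) : `|M^T| = `|M|.
Proof.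
apply/eqP; rewrite eq_le; apply/andP; split; apply/mx_norm_leP => // i j.
  by rewrite mxE le_mx_norm.
by have := le_mx_norm (M^T) j i; rewrite mxE.
Qed.

Lemma mulmx_continuous (R : realType) m n p (M : 'M[R]_(m, n)) :
  continuous (mulmx M : 'M[R]_(n, p) -> 'M[R]_(m, p)).
Proof.
move=> x; apply/(cvgrPdist_le (FF := nbhs_filter x)) => e e0.
have c0 : 0 < n%:R * `|M| + 1 by rewrite ltr_wpDl// mulr_ge0.
near=> y; rewrite -mulmxBr (le_trans (mx_norm_mulmx _ _))//.
apply: (@le_trans _ _ ((n%:R * `|M| + 1) * `|x - y|)).
  by rewrite ler_wpM2r// lerDl.
rewrite -ler_pdivlMl//; near: y.
by apply: cvgr_dist_le => //; rewrite mulr_gt0// invr_gt0.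
Unshelve. all: by end_near. Qed.

Lemma trmx_continuous (R : realType) m n :
  continuous (trmx : 'M[R]_(m, n) -> 'M[R]_(n, m)).
Proof.
move=> x; apply/(cvgrPdist_le (FF := nbhs_filter x)) => e e0; near=> y.
rewrite -linearB/= mx_norm_trmx; near: y.
exact: cvgr_dist_le.
Unshelve. all: by end_near. Qed.

(** Heine-Borel, carried over from row vectors by transposition, which is continuous and preserves
    the norm. *)
Lemma cV_compact (R : realType) n (K : set 'cV[R]_n) (M : R) :
  (forall x, K x -> `|x| <= M) -> closed K -> compact K.
Proof.
move=> KM Kcl.
have -> : K = trmx @` [set y : 'rV[R]_n | K y^T].
  apply/seteqP; split => [x Kx|_ [y Ky <-]//].
  by exists x^T; rewrite /= trmxK.
apply: continuous_compact; first exact/continuous_subspaceT/trmx_continuous.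
apply: bounded_closed_compact.
  exists M; split; first exact: num_real.
  by move=> c Mc y /= /KM; rewrite mx_norm_trmx => /le_trans; apply; exact: ltW.
by apply: (closed_comp (f := trmx)) => // y _; exact: trmx_continuous.
Qed.

(** * Jacobians and the mean value theorem *)

Lemma diff_jac (R : realType) n (G : 'cV[R]_n -> 'cV[R]_n) x w :
  'd G x w = jac G x *m w.
Proof.
apply/matrixP => i j; rewrite {j}(ord1 j).
have {1}-> : w = \sum_j w j 0 *: delta_mx j 0.
  by rewrite {1}[w]matrix_sum_delta; apply: eq_bigr => j _; rewrite big_ord1.
rewrite linear_sum summxE mxE; apply: eq_bigr => j _.
by rewrite linearZ !mxE mulrC.
Qed.

Lemma is_diff_linear_form (R : realType) n (L : 'rV[R]_n) (x : 'cV[R]_n) :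
  is_diff x (fun y : 'cV[R]_n => (L *m y) 0 0) (fun y => (L *m y) 0 0).
Proof.
have L_lin : linear (fun y : 'cV[R]_n => (L *m y) 0 0 : R).
  by move=> c y z; rewrite mulmxDr -scalemxAr !mxE.
pose LlM := GRing.isLinear.Build _ _ _ _ _ L_lin.
pose f : {linear _ -> _} := HB.pack (fun y : 'cV[R]_n => (L *m y) 0 0 : R) LlM.
have f_cont : continuous f.
  move=> y.
  apply: (continuous_comp (f := mulmx L) (g := fun N : 'M[R]_1 => N 0 0)).
    exact: mulmx_continuous.
  exact: coord_continuous.
rewrite (_ : (fun y : 'cV[R]_n => (L *m y) 0 0) = f)//.
by apply: DiffDef; [exact: linear_differentiable|rewrite diff_lin].
Qed.

(* For every linear form [L] the mean value theorem applies to [L \o G]; only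
   the intermediate point depends on [L]. *)
Lemma mvt_linear_form (R : realType) n (G : 'cV[R]_n -> 'cV[R]_n)
    (L : 'rV[R]_n) (u v : 'cV[R]_n) : (forall x, differentiable G x) ->
  exists2 t, t \in `[0, 1] &
    L *m (G u - G v) = L *m (jac G (v + t *: (u - v)) *m (u - v)).
Proof.
move=> dG.
pose p (t : R) := v + t *: (u - v).
pose f (t : R) := (L *m G (p t)) 0 0.
have fder (t : R) : is_derive t 1 f ((L *m (jac G (p t) *m (u - v))) 0 0).
  have pdiff : is_diff t p ( *:%R ^~ (u - v)).
    have -> : p = cst v + ( *:%R ^~ (u - v)) by apply/funext.
    have := is_diffD (is_diff_cst v t) (is_diff_scalel t (u - v)).
    by rewrite add0r.
  have Gdiff : is_diff (p t) G ('d G (p t)) by exact: differentiableP.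
  have Ldiff := is_diff_linear_form L (G (p t)).
  have fdiff := is_diff_comp (is_diff_comp pdiff Gdiff) Ldiff.
  have fdif : differentiable f t by case: fdiff.
  apply: DeriveDef; first exact: diff_derivable.
  rewrite deriveE//.
  have -> : 'd f t = (fun y : 'cV[R]_n => (L *m y) 0 0)
       \o ('d G (p t) \o ( *:%R ^~ (u - v))) :> (R -> R) by case: fdiff.
  by rewrite /= scale1r diff_jac.
have fcont : {within `[0, 1], continuous f}.
  by apply: derivable_within_continuous => t _; case: (fder t).
have [t t01 ft] := MVT_segment ler01 (fun t _ => fder t) fcont.
exists t => //; apply/matrixP => i j; rewrite !ord1.
move: ft; rewrite /f /p subr0 mulr1 scale1r scale0r addr0 (addrC v) subrK => <-.
by rewrite mulmxBr !mxE.
Qed.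

(** * Lower bounds on the expansion of a map with invertible Jacobian *)

(** With [L] the inverse Jacobian at [x], the matrix [L *m jac G z] is close to the identity for [z]
    near [x]. Hence [u - v] is [L *m (G u - G v)] up to an error of at most half its norm, which is
    absorbed on the left. *)
Lemma local_expansion (R : realType) n (G : 'cV[R]_n -> 'cV[R]_n)
    (x : 'cV[R]_n) :
  (forall z, differentiable G z) -> {for x, continuous (jac G)} ->
  jac G x \in unitmx ->
  exists2 c, 0 < c & exists2 e, 0 < e & forall u v, `|x - u| < e ->
    `|x - v| < e -> c * `|u - v| <= `|G u - G v|.
Proof.
move=> dG Gx_cont Gx_unit.
pose L := invmx (jac G x).
(* Makes [n%:R * d] at most one half; the factor [n] is the loss in [mx_norm_mulmx], and the [+ 1]
   covers [n = 0]. *)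
pose d : R := (2 * (n%:R + 1))^-1.
have d0 : 0 < d by rewrite invr_gt0 mulr_gt0// ltr_wpDl.
have nd : n%:R * d <= 2^-1.
  rewrite /d invfM mulrCA ler_piMr// ler_pdivrMr ?ltr_wpDl//.
  by rewrite mul1r lerDl.
have LG : (fun z => L *m jac G z) @ x --> (1%:M : 'M[R]_n).
  rewrite -(mulVmx Gx_unit).
  exact: (cvg_comp _ _ Gx_cont (mulmx_continuous (M := L) (x := jac G x))).
have /nbhs_ballP[e /= e0 He] : \forall z \near x, `|1%:M - L *m jac G z| <= d.
  exact: (@cvgr_dist_le _ _ _ _ _ _ _ LG _ d0).
have c0 : 0 < 2 * (n%:R * `|L|) + 1 by rewrite ltr_wpDl// !mulr_ge0.
exists (2 * (n%:R * `|L|) + 1)^-1; first by rewrite invr_gt0.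
exists e => // u v xu xv.
rewrite ler_pdivrMl//.
suff : `|u - v| <= n%:R * `|L| * `|G u - G v| + 2^-1 * `|u - v|.
  by have := normr_ge0 (G u - G v); nra.
apply/mx_norm_leP => [|i j]; first by rewrite addr_ge0// !mulr_ge0.
rewrite {j}(ord1 j).
have [t t01] := mvt_linear_form (row i L) u v dG.
rewrite mulmxA -!row_mul; set p := v + _ => /matrixP/(_ 0 0).
rewrite [LHS]mxE [RHS]mxE => Hp.
have xp : `|x - p| < e.
  have -> : x - p = (1 - t) *: (x - v) + t *: (x - u).
    by apply/matrixP => k l; rewrite !mxE; ring.
  move: t01; rewrite in_itv/= => /andP[t0 t1].
  rewrite (le_lt_trans (ler_normD _ _))// !normrZ !ger0_norm ?subr_ge0//.
  have [xvu|/ltW xuv] := leP `|x - v| `|x - u|.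
    by apply: le_lt_trans xu; nra.
  by apply: le_lt_trans xv; nra.
have -> : (u - v) i 0 = (L *m (G u - G v)) i 0
    + ((1%:M - L *m jac G p) *m (u - v)) i 0.
  rewrite Hp mulmxBl mul1mx [X in _ = _ + X]mxE [X in _ = _ + (_ + X)]mxE.
  by rewrite addrC subrK.
rewrite (le_trans (ler_normD _ _))// lerD//.
  by rewrite (le_trans (le_mx_norm _ _ _))// mx_norm_mulmx.
rewrite (le_trans (le_mx_norm _ _ _))// (le_trans (mx_norm_mulmx _ _))//.
rewrite ler_wpM2r// (le_trans _ nd)// ler_wpM2l//.
by apply: He; rewrite -ball_normE.
Qed.

(** Compactness makes the local constants uniform. One [c] serves as both radius and factor, since
    decreasing it weakens both requirements; only [u] is confined to [K], so [v] may leave it. *)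
Lemma uniform_expansion (R : realType) n (G : 'cV[R]_n -> 'cV[R]_n)
    (K : set 'cV[R]_n) :
  (forall z, differentiable G z) -> continuous (jac G) ->
  (forall z, jac G z \in unitmx) -> compact K ->
  exists2 c, 0 < c & forall u v, K u -> `|u - v| <= c ->
    c * `|u - v| <= `|G u - G v|.
Proof.
move=> dG Gcont Gunit /compact_near_coveringP Kcov.
have /Kcov : forall x, K x -> \forall y \near x & c \near 0^'+,
    forall v, `|y - v| <= c -> c * `|y - v| <= `|G y - G v|.
  move=> x _.
  have [c c0 [e e0 ce]] := local_expansion dG (Gcont x) (Gunit x).
  have e20 : 0 < e / 2 by rewrite divr_gt0.
  near=> y d => v yv.
  have dc : d <= c by near: d; exact: nbhs_right_le.
  have de : d < e / 2 by near: d; exact: nbhs_right_lt.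
  have xy : `|x - y| < e / 2.
    by near: y; exact: (@cvgr_dist_lt _ _ _ _ _ id x).
  apply: (@le_trans _ _ (c * `|y - v|)); first by rewrite ler_wpM2r.
  apply: ce; first by rewrite (lt_trans xy)// ltr_pdivrMr// ltr_pMr// ltr1n.
  rewrite -(subrK y x) -addrA (le_lt_trans (ler_normD _ _))//.
  by rewrite [e](splitr e) ltrD// (le_lt_trans yv).
move=> H.
have [c [c0 Hc]] : exists c, 0 < c /\ K `<=` [set x | forall v, `|x - v| <= c ->
    c * `|x - v| <= `|G x - G v|].
  near (0 : R)^'+ => c; exists c; split; first by near: c; exact: nbhs_right_gt.
  by near: c.
by exists c => // u v /Hc; exact.
Unshelve. all: by end_near. Qed.

(** * Minimising the distance to a target: surjectivity *)

(** If [G z] differed from [y], a step [- (t *: w)] along the Newton direction would turn [G z - y]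
    into [(1 - t) *: (G z - y)] up to an error of at most [r * t / 2], which for small [t] brings
    the image closer to [y]. *)
Lemma local_min_dist_eq (R : realType) n (G : 'cV[R]_n -> 'cV[R]_n)
    (z y : 'cV[R]_n) :
  differentiable G z -> jac G z \in unitmx ->
  (\forall u \near z, `|G z - y| <= `|G u - y|) -> G z = y.
Proof.
move=> dG Gunit /nbhs_ballP[e1 /= e10 zmin].
apply/eqP; rewrite -subr_eq0; apply: contraT => r0.
have {}r0 : 0 < `|G z - y| by rewrite normr_gt0.
set r := `|G z - y| in r0 *.
pose w := invmx (jac G z) *m (G z - y).
have w0 : 0 < `|w| + 1 by rewrite ltr_wpDl.
(* Tolerance for the first-order remainder, set so that a step of norm at most [t] times (norm of
   [w] plus one) costs at most [r * t / 2]. *)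
have d0 : 0 < r / (2 * (`|w| + 1)) by rewrite divr_gt0// mulr_gt0.
have [_ /eqaddoP/(_ _ d0)] := (diff_locallyP z G).1 dG.
move=> /nbhs_ballP[e2 /= e20 Gz].
near (0 : R)^'+ => t.
have t0 : 0 < t by near: t; exact: nbhs_right_gt.
have t1 : t <= 1 by near: t; exact: nbhs_right_le.
have te1 : t * (`|w| + 1) < e1.
  by rewrite -ltr_pdivlMr//; near: t; apply: nbhs_right_lt; rewrite divr_gt0.
have te2 : t * (`|w| + 1) < e2.
  by rewrite -ltr_pdivlMr//; near: t; apply: nbhs_right_lt; rewrite divr_gt0.
have tw : `|t *: w| <= t * (`|w| + 1).
  by rewrite normrZ gtr0_norm// ler_pM2l// lerDl.
have := zmin (z - t *: w).
rewrite -ball_normE/= opprD addNKr opprK (le_lt_trans tw)// => /(_ isT).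
have := Gz (- (t *: w)).
rewrite -ball_normE/= sub0r opprK (le_lt_trans tw)// => /(_ isT).
have -> : (G \o shift z - (cst (G z) + 'd G z)) (- (t *: w))
    = G (z - t *: w) - (G z - t *: (G z - y)).
  transitivity (G (- (t *: w) + z) - (G z + 'd G z (- (t *: w)))); first by [].
  by rewrite diff_jac mulmxN -scalemxAr mulKVmx// [- _ + z]addrC.
rewrite normrN => Gzw.
suff : `|G (z - t *: w) - y| < r by move=> /lt_le_trans/[apply]; rewrite ltxx.
have -> : G (z - t *: w) - y = (G (z - t *: w) - (G z - t *: (G z - y)))
    + (1 - t) *: (G z - y).
  by apply/matrixP => k l; rewrite !mxE; ring.
rewrite (le_lt_trans (ler_normD _ _))// [`|(1 - t) *: _|]normrZ.
rewrite [`|1 - t|]ger0_norm ?subr_ge0// -/r.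
have dw : r / (2 * (`|w| + 1)) * (t * (`|w| + 1)) = r * t / 2.
  by field; rewrite gt_eqF.
have := le_trans Gzw (ler_wpM2l (ltW d0) tw); rewrite dw => Gzw'.
have rt : 0 < r * t by rewrite mulr_gt0.
by lra.
Unshelve. all: by end_near. Qed.

Lemma closed_norm_le (R : realType) n (f : 'cV[R]_n -> 'cV[R]_n) (M : R) :
  continuous f -> closed [set x | `|f x| <= M].
Proof.
move=> f_cont.
apply: (closed_comp (f := fun x => `|f x|) (D := [set r | r <= M])).
  by move=> x _; exact: (cvg_norm (F := nbhs x) (f_cont x)).
exact: closed_le.
Qed.

(** A quantitative open mapping property: the distance to [y] is minimised over the closed ball of
    radius [r] around [u], and expansion keeps the minimiser off the sphere, so [local_min_dist_eq]
    applies. *)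
Lemma expansion_surj (R : realType) n (G : 'cV[R]_n -> 'cV[R]_n)
    (u y : 'cV[R]_n) (c r : R) :
  (forall z, differentiable G z) -> (forall z, jac G z \in unitmx) ->
  0 < r <= c -> (forall v, `|u - v| <= c -> c * `|u - v| <= `|G u - G v|) ->
  `|y - G u| < c * r / 2 -> exists2 z, `|u - z| < r & G z = y.
Proof.
move=> dG Gunit /andP[r0 rc] uc yu.
have Gcont x : {for x, continuous G} by exact: differentiable_continuous.
pose S : set 'cV[R]_n := [set z | `|u - z| <= r].
have Scompact : compact S.
  apply: (@cV_compact _ _ _ (`|u| + r)).
    move=> z /= zr; rewrite -(subrK u z) addrC (le_trans (ler_normD _ _))//.
    by rewrite lerD2l distrC.
  apply: (closed_norm_le (f := fun z => u - z)) => z.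
  by apply: (cvgB (F := nbhs z)); [exact: cvg_cst|exact: cvg_id].
have S0 : S !=set0 by exists u; rewrite /S/= subrr normr0 ltW.
have /(compact_EVT_min S0 Scompact)[z] :
    {within S, continuous (fun z => `|G z - y|)}.
  apply: continuous_subspaceT => z.
  apply: (cvg_norm (F := nbhs z)).
  by apply: (cvgB (F := nbhs z)); [exact: Gcont|exact: cvg_cst].
rewrite inE => Sz zmin.
have zu : `|G z - y| <= `|y - G u|.
  by rewrite [leRHS]distrC zmin// inE /S/= subrr normr0 ltW.
have uz : `|u - z| < r.
  (* On the sphere, [c * r] would be at most the distance from [G u] to [G z], hence at most twice
     that from [y] to [G u], against the hypothesis on [y]. *)
  rewrite lt_neqAle Sz andbT; apply: contraTN yu => /eqP uz.
  rewrite -leNgt ler_pdivrMr// -{1}uz (le_trans (uc _ _)) ?uz//.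
  rewrite (le_trans (ler_distD y _ _))//.
  rewrite [`|G u - y|]distrC [`|y - G z|]distrC.
  by lra.
exists z => //; apply: local_min_dist_eq => //.
apply/nbhs_ballP; exists (r - `|u - z|) => [|v]; first by rewrite /= subr_gt0.
rewrite -ball_normE /= ltrBrDl => zv; apply: zmin.
by rewrite inE /S/= (le_trans (ler_distD z _ _))// ltW.
Qed.

(** Properness makes the sublevel set of the point [0] compact; a minimiser over it is global,
    because the distance to [y] is larger outside. *)
Lemma proper_surjective (R : realType) n (G : 'cV[R]_n -> 'cV[R]_n)
    (y : 'cV[R]_n) :
  (forall z, differentiable G z) -> (forall z, jac G z \in unitmx) ->
  (forall M, exists B, forall x, `|G x| <= M -> `|x| <= B) ->
  exists x, G x = y.
Proof.
move=> dG Gunit Gproper.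
have Gcont x : {for x, continuous G} by exact: differentiable_continuous.
pose S : set 'cV[R]_n := [set z | `|G z - y| <= `|G 0 - y|].
have Scompact : compact S.
  have [B GB] := Gproper (`|G 0 - y| + `|y|).
  apply: (@cV_compact _ _ _ B).
    move=> z /= zr; apply: GB; rewrite -(subrK y (G z)).
    by rewrite (le_trans (ler_normD _ _))// lerD2r.
  apply: (closed_norm_le (f := fun z => G z - y)) => z.
  by apply: (cvgB (F := nbhs z)); [exact: Gcont|exact: cvg_cst].
have S0 : S 0 by rewrite /S/=.
have /(compact_EVT_min (ex_intro _ _ S0) Scompact)[z] :
    {within S, continuous (fun z => `|G z - y|)}.
  apply: continuous_subspaceT => z.
  apply: (cvg_norm (F := nbhs z)).
  by apply: (cvgB (F := nbhs z)); [exact: Gcont|exact: cvg_cst].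
rewrite inE => Sz zmin.
exists z; apply: local_min_dist_eq => //; near=> v.
have [Sv|/ltW Sv] := leP `|G v - y| `|G 0 - y|.
  by apply: zmin; rewrite inE.
exact: le_trans Sv.
Unshelve. all: by end_near. Qed.

(** * Lifting the contraction of a loop: injectivity *)

Lemma uniform_continuity_compact (R : realType) n (G : 'cV[R]_n -> 'cV[R]_n)
    (K : set 'cV[R]_n) (e : R) : continuous G -> compact K -> 0 < e ->
  exists2 d, 0 < d & forall u v, K u -> `|u - v| <= d -> `|G u - G v| <= e.
Proof.
move=> Gcont /compact_near_coveringP Kcov e0.
have /Kcov : forall x, K x -> \forall y \near x & d \near 0^'+,
    forall v, `|y - v| <= d -> `|G y - G v| <= e.
  move=> x _.
  have e20 : 0 < e / 2 by rewrite divr_gt0.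
  have /nbhs_ballP[r /= r0 Gr] : \forall y \near x, `|G x - G y| <= e / 2.
    exact: (@cvgr_dist_le _ _ _ _ _ _ _ (Gcont x) _ e20).
  have r20 : 0 < r / 2 by rewrite divr_gt0.
  near=> y d => v yv.
  have dr : d < r / 2 by near: d; exact: nbhs_right_lt.
  have xy : `|x - y| < r / 2 by near: y; exact: (@cvgr_dist_lt _ _ _ _ _ id x).
  rewrite (le_trans (ler_distD (G x) _ _))// [e]splitr lerD//.
    rewrite distrC; apply: Gr; rewrite -ball_normE/= (lt_trans xy)//.
    by rewrite ltr_pdivrMr// ltr_pMr// ltr1n.
  apply: Gr; rewrite -ball_normE/= (le_lt_trans (ler_distD y _ _))//.
  by rewrite [r]splitr ltrD// (le_lt_trans yv).
move=> H.
near (0 : R)^'+ => d; exists d; first by near: d; exact: nbhs_right_gt.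
have Kd : K `<=` [set x | forall v, `|x - v| <= d -> `|G x - G v| <= e].
  by near: d.
by move=> u v /Kd; exact.
Unshelve. all: by end_near. Qed.

(* The loop of images of the segment from [x1] to [x2], sampled at [m + 1]
   points, is contracted radially to [y] in [N] steps. Each step is lifted
   through [G] by [expansion_surj], and neighbouring lifts stay [c]-close, so
   that [G] expands their distances; the end points, lying over [y], do not
   move. At the end all lifts lie over [y] and hence coincide. *)
Lemma proper_injective (R : realType) n (G : 'cV[R]_n -> 'cV[R]_n)
    (x1 x2 : 'cV[R]_n) :
  (forall z, differentiable G z) -> continuous (jac G) ->
  (forall z, jac G z \in unitmx) ->
  (forall M, exists B, forall x, `|G x| <= M -> `|x| <= B) ->
  G x1 = G x2 -> x1 = x2.
Proof.
move=> dG jcont Gunit Gproper Gx12.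
have Gcont : continuous G by move=> x; exact: differentiable_continuous.
pose y := G x1.
pose S : set 'cV[R]_n := [set z | `|z| <= `|x1| + `|x2|].
have Scompact : compact S.
  apply: (@cV_compact _ _ _ (`|x1| + `|x2|)) => //.
  by apply: (closed_norm_le (f := id)); move=> z; exact: cvg_id.
have S0 : S !=set0 by exists x1; rewrite /S/= lerDl.
have [Q Q0 SQ] : exists2 Q, 0 < Q & forall x, S x -> `|G x - y| <= Q.
  have /(compact_EVT_max S0 Scompact)[z _ zmax] :
      {within S, continuous (fun z => `|G z - y|)}.
    apply: continuous_subspaceT => z.
    apply: (cvg_norm (F := nbhs z)).
    by apply: (cvgB (F := nbhs z)); [exact: Gcont|exact: cvg_cst].
  exists (`|G z - y| + 1); first by rewrite ltr_wpDl.
  by move=> x Sx; rewrite (le_trans (zmax _ _)) ?inE// lerDl.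
(* The preimage of a ball around the origin that contains every stage of the contracted loop, so
   that all lifts lie in [K]. *)
pose K : set 'cV[R]_n := [set x | `|G x| <= `|y| + Q].
have Kcompact : compact K.
  have [B GB] := Gproper (`|y| + Q).
  by apply: (@cV_compact _ _ _ B) => //; exact: closed_norm_le.
have [c c0 Kc] := uniform_expansion dG jcont Gunit Kcompact.
have c30 : 0 < c / 3 by rewrite divr_gt0.
have cc30 : 0 < c * (c / 3) by rewrite mulr_gt0.
have [d d0 Sd] := uniform_continuity_compact Gcont Scompact cc30.
(* The mesh: neighbouring samples are within [c / 3], and within [d], so that their images are
   within [c * (c / 3)]. *)
have [m Hm] : exists m : nat, `|x2 - x1| <= m.+1%:R * Num.min d (c / 3).
  have mu0 : 0 < Num.min d (c / 3) by rewrite lt_min d0.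
  exists (Num.bound (`|x2 - x1| / Num.min d (c / 3))).
  rewrite -ler_pdivrMr// ltW// (lt_le_trans (archi_boundP _)) ?ler_nat//.
  by rewrite divr_ge0// ltW.
(* Each stage moves an image by at most [Q / N.+1%:R], which must stay below the bound [c * r / 2]
   of [expansion_surj] with [r = c / 3]. *)
have [N HN] : exists N : nat, Q < N.+1%:R * (c * (c / 3) / 2).
  have cc60 : 0 < c * (c / 3) / 2 by rewrite divr_gt0.
  exists (Num.bound (Q / (c * (c / 3) / 2))).
  rewrite -ltr_pdivrMr// (lt_le_trans (archi_boundP _)) ?ler_nat//.
  by rewrite divr_ge0// ltW.
pose p0 (i : nat) := x1 + (i%:R / m.+1%:R) *: (x2 - x1).
have Sp0 i : (i <= m.+1)%N -> S (p0 i).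
  move=> im; have t1 : i%:R / m.+1%:R <= 1 :> R.
    by rewrite ler_pdivrMr ?ltr0n// mul1r ler_nat.
  have t0 : 0 <= i%:R / m.+1%:R :> R by rewrite divr_ge0.
  rewrite /S/= /p0; move: (i%:R / _) t0 t1 => t t0 t1.
  have -> : x1 + t *: (x2 - x1) = (1 - t) *: x1 + t *: x2.
    by apply/matrixP => k l; rewrite !mxE; ring.
  rewrite (le_trans (ler_normD _ _))// !normrZ !ger0_norm ?subr_ge0//.
  by rewrite lerD// ler_piMl// gerBl.
have p0d i : `|p0 i - p0 i.+1| <= Num.min d (c / 3).
  have -> : p0 i - p0 i.+1 = - (m.+1%:R^-1 *: (x2 - x1)).
    rewrite /p0 -[i.+1]addn1 natrD.
    by apply/matrixP => k l; rewrite !mxE; ring.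
  by rewrite normrN normrZ ger0_norm ?invr_ge0// ler_pdivrMl ?ltr0n.
have step k : (k <= N.+1)%N -> exists p : nat -> 'cV[R]_n,
    [/\ p 0 = x1, p m.+1 = x2,
      forall i, (i <= m.+1)%N ->
        G (p i) = y + (1 - k%:R / N.+1%:R) *: (G (p0 i) - y)
      & forall i, (i < m.+1)%N -> `|p i - p i.+1| <= c / 3].
  elim: k => [_|k IH kN].
    exists p0; split => // [||i im|i im].
    - by rewrite /p0 mul0r scale0r addr0.
    - by rewrite /p0 divff ?pnatr_eq0// scale1r addrC subrK.
    - by rewrite mul0r subr0 scale1r addrC subrK.
    - by rewrite (le_trans (p0d i))// ge_min lexx orbT.
  have [p [p1 p2 pG pd]] := IH (ltnW kN).
  pose t (j : nat) : R := 1 - j%:R / N.+1%:R.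
  have t0 j : (j <= N.+1)%N -> 0 <= t j.
    by move=> jN; rewrite subr_ge0 ler_pdivrMr ?ltr0n// mul1r ler_nat.
  have t1 j : t j <= 1 by rewrite gerBl divr_ge0.
  have tk : t k - t k.+1 = N.+1%:R^-1.
    by rewrite /t -[k.+1]addn1 natrD; field.
  have KG j x i : (j <= N.+1)%N -> (i <= m.+1)%N ->
      G x = y + t j *: (G (p0 i) - y) -> K x.
    move=> jN im Gx; rewrite /K/= Gx (le_trans (ler_normD _ _))// lerD2l.
    rewrite normrZ ger0_norm ?t0// (le_trans _ (SQ _ (Sp0 _ im)))//.
    by rewrite ler_piMl.
  (* The last clause freezes the samples whose original image is [y], in particular both end points;
     indices beyond [m.+1] get the default [0]. *)
  have lift i : exists z, (i <= m.+1)%N ->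
      [/\ `|p i - z| < c / 3, G z = y + t k.+1 *: (G (p0 i) - y)
        & G (p0 i) = y -> z = p i].
    have [im|_] := leqP i m.+1; last by exists 0.
    have [Gy|Gy] := eqVneq (G (p0 i)) y.
      exists (p i) => _; split => //; first by rewrite subrr normr0.
      by rewrite pG// Gy subrr !scaler0.
    have [|v pv||z piz Gz] := @expansion_surj _ _ G (p i)
        (y + t k.+1 *: (G (p0 i) - y)) c (c / 3) dG Gunit.
    - by rewrite c30 ler_pdivrMr// ler_peMr ?ler1n// ltW.
    - by apply: Kc => //; exact: (KG k _ i (ltnW kN) im (pG _ im)).
    - rewrite pG// -/(t k) opprD addrACA subrr add0r -scalerBl normrZ distrC tk.
      rewrite ger0_norm ?invr_ge0// ltr_pdivrMl ?ltr0n//.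
      by rewrite (le_lt_trans _ HN)//; exact: SQ (Sp0 _ im).
    - by exists z => _; split => // /eqP; rewrite (negPf Gy).
  have [z Hz] := choice lift.
  exists z; split.
  - have [//|_ _ ->] := Hz 0%N; rewrite ?p1//.
    by rewrite /p0 mul0r scale0r addr0.
  - have [//|_ _ ->] := Hz m.+1; rewrite ?p2//.
    by rewrite /p0 divff ?pnatr_eq0// scale1r addrC subrK.
  - by move=> i /Hz[].
  - move=> i im.
    have [piz Gz _] := Hz i (ltnW im).
    have [piz' Gz' _] := Hz i.+1 im.
    (* Three gaps of at most [c / 3] add up to at most [c], so expansion applies; as the images are
       at most [c * (c / 3)] apart, the new gap is again at most [c / 3]. *)
    have zc : `|z i - z i.+1| <= c.
      rewrite (le_trans (ler_distD (p i) _ _))// [`|z i - _|]distrC.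
      have := ler_distD (p i.+1) (p i) (z i.+1).
      by have := pd i im; lra.
    have := Kc _ _ (KG _ _ _ kN (ltnW im) Gz) zc.
    move=> zGz; rewrite -(ler_pM2l c0) (le_trans zGz)//.
    rewrite Gz Gz' opprD addrACA subrr add0r -scalerBr opprB addrA subrK.
    rewrite normrZ ger0_norm ?t0// (le_trans (ler_piMl _ _))//.
    apply: Sd; first exact: Sp0 (ltnW im).
    by rewrite (le_trans (p0d i))// ge_min lexx.
have [p [p1 p2 pG pd]] := step N.+1 (leqnn _).
have {}pG i : (i <= m.+1)%N -> G (p i) = y.
  by move=> im; rewrite pG// divff ?pnatr_eq0// subrr scale0r addr0.
rewrite -p1 -p2.
have : forall i, (i <= m.+1)%N -> p 0 = p i.
  elim=> [//|i IH im]; rewrite IH ?(ltnW im)//.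
  apply/eqP; rewrite -subr_eq0 -normr_le0.
  have /Kc : K (p i) by rewrite /K/= pG ?(ltnW im)// lerDl ltW.
  move=> /(_ (p i.+1)).
  rewrite !pG ?(ltnW im)// subrr normr0 pmulr_rle0//; apply.
  by rewrite (le_trans (pd _ im))// ler_pdivrMr// ler_peMr ?(ltW c0)// ler1n.
by apply.
Qed.

(** * The Euclidean inner product and norm *)

Definition dotc (R : realType) n (u v : 'cV[R]_n) : R :=
  \sum_(i < n) u i 0 * v i 0.

Lemma dotcE (R : realType) n (u v : 'cV[R]_n) : dotc u v = (u^T *m v) 0 0.
Proof. by rewrite mxE; apply: eq_bigr => i _; rewrite mxE. Qed.

Lemma dotcC (R : realType) n (u v : 'cV[R]_n) : dotc u v = dotc v u.
Proof. by apply: eq_bigr => i _; rewrite mulrC. Qed.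

Lemma dotcDr (R : realType) n (u v w : 'cV[R]_n) :
  dotc u (v + w) = dotc u v + dotc u w.
Proof. by rewrite !dotcE mulmxDr mxE. Qed.

Lemma dotcZr (R : realType) n a (u v : 'cV[R]_n) :
  dotc u (a *: v) = a * dotc u v.
Proof. by rewrite !dotcE -scalemxAr mxE. Qed.

Lemma dotcDl (R : realType) n (u v w : 'cV[R]_n) :
  dotc (v + w) u = dotc v u + dotc w u.
Proof. by rewrite !(dotcC _ u) dotcDr. Qed.

Lemma dotcZl (R : realType) n a (u v : 'cV[R]_n) :
  dotc (a *: v) u = a * dotc v u.
Proof. by rewrite !(dotcC _ u) dotcZr. Qed.

Lemma dotc_trmx (R : realType) m n (M : 'M[R]_(m, n)) u v :
  dotc (M^T *m u) v = dotc u (M *m v).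
Proof. by rewrite !dotcE trmx_mul trmxK mulmxA. Qed.

Lemma dotc_ge0 (R : realType) n (u : 'cV[R]_n) : 0 <= dotc u u.
Proof. by apply: sumr_ge0 => i _; rewrite -expr2 sqr_ge0. Qed.

Lemma dotc_eq0 (R : realType) n (u : 'cV[R]_n) : (dotc u u == 0) = (u == 0).
Proof.
apply/eqP/eqP => [/eqP|->]; last by apply: big1 => i _; rewrite mxE mul0r.
rewrite psumr_eq0 => [/allP u0|i _]; last by rewrite -expr2 sqr_ge0.
apply/colP => i; have := u0 i (mem_index_enum _).
by rewrite mxE /= -expr2 sqrf_eq0 => /eqP.
Qed.

Lemma enormE (R : realType) n (u : 'cV[R]_n) : enorm u = Num.sqrt (dotc u u).
Proof. by congr Num.sqrt; apply: eq_bigr => i _; rewrite expr2. Qed.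

Lemma enorm_ge0 (R : realType) n (u : 'cV[R]_n) : 0 <= enorm u.
Proof. exact: sqrtr_ge0. Qed.

Lemma sqr_enorm (R : realType) n (u : 'cV[R]_n) : enorm u ^+ 2 = dotc u u.
Proof. by rewrite enormE sqr_sqrtr// dotc_ge0. Qed.

Lemma enorm_eq0 (R : realType) n (u : 'cV[R]_n) : (enorm u == 0) = (u == 0).
Proof. by rewrite -sqrf_eq0 sqr_enorm dotc_eq0. Qed.

(** Cauchy-Schwarz: expand the squared length of [enorm v *: u - enorm u *: v] and divide by
    [enorm u * enorm v]. *)
Lemma dotc_le_enorm (R : realType) n (u v : 'cV[R]_n) :
  dotc u v <= enorm u * enorm v.
Proof.
have [->|u0] := eqVneq u 0.
  by rewrite /dotc big1 ?mulr_ge0 ?enorm_ge0// => i _; rewrite mxE mul0r.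
have [->|v0] := eqVneq v 0.
  by rewrite /dotc big1 ?mulr_ge0 ?enorm_ge0// => i _; rewrite mxE mulr0.
have {}u0 : 0 < enorm u by rewrite lt_def enorm_eq0 u0 enorm_ge0.
have {}v0 : 0 < enorm v by rewrite lt_def enorm_eq0 v0 enorm_ge0.
have := dotc_ge0 (enorm v *: u + (- enorm u) *: v).
rewrite dotcDl !dotcDr !dotcZl !dotcZr -!sqr_enorm (dotcC v u) => H.
have uv0 : 0 < enorm u * enorm v by rewrite mulr_gt0.
rewrite -(ler_pM2l uv0).
by lra.
Qed.

Lemma enormD (R : realType) n (u v : 'cV[R]_n) :
  enorm (u + v) <= enorm u + enorm v.
Proof.
rewrite -ler_sqr ?nnegrE ?addr_ge0 ?enorm_ge0//.
rewrite sqr_enorm dotcDl !dotcDr (dotcC v u) sqrrD !sqr_enorm.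
have := dotc_le_enorm u v; lra.
Qed.

Lemma enormN (R : realType) n (u : 'cV[R]_n) : enorm (- u) = enorm u.
Proof. by congr Num.sqrt; apply: eq_bigr => i _; rewrite mxE sqrrN. Qed.

Lemma enormB (R : realType) n (u v : 'cV[R]_n) :
  enorm u - enorm v <= enorm (u - v).
Proof. by rewrite lerBlDr -{1}(subrK v u) enormD. Qed.

Lemma le_norm_enorm (R : realType) n (u : 'cV[R]_n) : `|u| <= enorm u.
Proof.
apply/mx_norm_leP => [|i j]; first exact: enorm_ge0.
rewrite (ord1 j) -sqrtr_sqr ler_wsqrtr// (bigD1 i)//= lerDl sumr_ge0// => k _.
exact: sqr_ge0.
Qed.

Lemma le_enorm_norm (R : realType) n (u : 'cV[R]_n) :
  enorm u <= Num.sqrt n%:R * `|u|.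
Proof.
rewrite -[`|u|]ger0_norm// -sqrtr_sqr -sqrtrM// ler_wsqrtr//.
have -> : n%:R * `|u| ^+ 2 = \sum_(i < n) `|u| ^+ 2.
  by rewrite sumr_const card_ord mulr_natl.
apply: ler_sum => i _.
by rewrite -[u i 0 ^+ 2]real_normK ?num_real// ler_sqr ?nnegrE// le_mx_norm.
Qed.

(** * Rayleigh quotients and singular values *)

Lemma dotc_mulmx_continuous (R : realType) n (M : 'M[R]_n) :
  continuous (fun x : 'cV[R]_n => dotc x (M *m x)).
Proof.
move=> x; apply: (cvg_big add_continuous (F := nbhs x)) => i _.
apply: (cvgM (F := nbhs x)); first exact: coord_continuous.
apply: (cvg_comp (F := nbhs x) (mulmx M) (fun y : 'cV[R]_n => y i 0)).
  exact: mulmx_continuous.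
exact: coord_continuous.
Qed.

(* [l] is the minimum of the Rayleigh quotient; perturbing a minimiser [c] in
   the direction [M c - l c] shows [M c = l c]. *)
Lemma eigenvalue_le_rayleigh (R : realType) n (M : 'M[R]_n) :
  (0 < n)%N -> M^T = M ->
  exists2 l, eigenvalue M l & forall x, l * dotc x x <= dotc x (M *m x).
Proof.
move=> n0 MT.
pose S : set 'cV[R]_n := [set x | dotc x x = 1].
have S0 : S !=set0.
  exists (delta_mx (Ordinal n0) 0); rewrite /S/= /dotc (bigD1 (Ordinal n0))//=.
  rewrite big1 ?addr0 => [|i /negPf i0]; first by rewrite mxE !eqxx mulr1.
  by rewrite mxE i0 mul0r.
have Scompact : compact S.
  apply: (@cV_compact _ _ _ 1) => [x /= x1|].
    by rewrite (le_trans (le_norm_enorm _))// enormE x1 sqrtr1.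
  apply: (closed_comp (f := fun x : 'cV[R]_n => dotc x x) (D := [set 1])).
    move=> x _; have := @dotc_mulmx_continuous R n 1%:M x.
    by under eq_fun do rewrite mul1mx.
  exact: closed_eq.
have /(compact_EVT_min S0 Scompact)[c] :
    {within S, continuous (fun x => dotc x (M *m x))}.
  exact/continuous_subspaceT/dotc_mulmx_continuous.
rewrite inE /S/= => c1 cmin.
pose l := dotc c (M *m c).
have lmin x : l * dotc x x <= dotc x (M *m x).
  have [->|x0] := eqVneq x 0.
    by rewrite mulmx0 /dotc !big1 ?mulr0// => i _; rewrite mxE mul0r.
  have xx0 : 0 < dotc x x by rewrite lt_def dotc_eq0 x0 dotc_ge0.
  have := cmin ((enorm x)^-1 *: x).
  rewrite inE/= -scalemxAr !dotcZl !dotcZr !mulrA -invfM -expr2 sqr_enorm.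
  by rewrite mulVf ?gt_eqF// -ler_pdivlMr// mulrC => /(_ erefl).
exists l => //.
pose N := M - l%:M.
have NE x : N *m x = M *m x + (- l) *: x.
  by rewrite mulmxBl mul_scalar_mx scaleNr.
have Nge0 x : 0 <= dotc x (N *m x).
  by rewrite NE dotcDr dotcZr mulNr subr_ge0.
have Nc0 : dotc c (N *m c) = 0.
  by rewrite NE dotcDr dotcZr c1 mulr1 subrr.
have Nsym u v : dotc u (N *m v) = dotc (N *m u) v.
  by rewrite -dotc_trmx /N linearB/= MT tr_scalar_mx.
have Nc : N *m c = 0.
  apply/eqP; rewrite -dotc_eq0.
  set w := N *m c; set s := dotc w w; set D := dotc w (N *m w).
  have D0 : 0 <= D := Nge0 w.
  have s0 : 0 <= s := dotc_ge0 w.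
  have D1 : 0 < D + 1 by rewrite ltr_wpDl.
  (* The form of [N] at this point is [- (s ^+ 2 * (D + 2) / (D + 1) ^+ 2)], so its nonnegativity
     forces [s = 0]; [D + 1] in place of [D] avoids a zero denominator. *)
  have := Nge0 (c + (- (s / (D + 1))) *: w).
  rewrite mulmxDr -scalemxAr dotcDl !dotcDr !dotcZl !dotcZr Nc0.
  rewrite (Nsym c) -/w -/s -/D.
  have -> : 0 + - (s / (D + 1)) * s + (- (s / (D + 1)) * s
      + - (s / (D + 1)) * (- (s / (D + 1)) * D))
      = - (s ^+ 2 * (D + 2) / (D + 1) ^+ 2).
    by field; rewrite gt_eqF.
  rewrite oppr_ge0 pmulr_lle0 ?invr_gt0 ?exprn_gt0// pmulr_lle0 ?ltr_wpDl//.
  by rewrite -sqrf_eq0 eq_le sqr_ge0 andbT.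
(* Eigenvectors are row vectors in [eigenvalueP]; the symmetry of [M] allows transposing [c]. *)
apply/eigenvalueP; exists c^T.
  rewrite -{1}MT -trmx_mul -linearZ/=; congr trmx; apply/eqP.
  by rewrite -subr_eq0 -scaleNr -NE Nc.
rewrite trmx_eq0; apply: contra_eq_neq c1 => ->.
by rewrite /dotc big1 ?(eq_sym 0) ?oner_neq0// => i _; rewrite mxE mul0r.
Qed.

(** An eigenvalue is the Rayleigh quotient at its eigenvector, so it lies between the extrema of the
    quotient. *)
Lemma rayleigh_eigenvalue (R : realType) n (M : 'M[R]_n) m :
  M^T = M -> eigenvalue M m ->
  exists2 x : 'cV[R]_n, 0 < dotc x x & dotc x (M *m x) = m * dotc x x.
Proof.
move=> MT /eigenvalueP[v vM v0]; exists v^T.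
  by rewrite lt_def dotc_eq0 trmx_eq0 v0 dotc_ge0.
by rewrite -{1}MT -trmx_mul vM linearZ/= dotcZr.
Qed.

(** The minimum of the Rayleigh quotient is an eigenvalue below all others, which determines the
    value chosen by [get]. *)
Lemma smallest_eigenvalue_le (R : realType) n (M : 'M[R]_n) (x : 'cV[R]_n) :
  M^T = M -> smallest_eigenvalue M * dotc x x <= dotc x (M *m x).
Proof.
(* For [n = 0], where [get] may return anything, both sides vanish. *)
move=> MT; have [n0|n0] := posnP n.
  by move: M x {MT}; rewrite n0 => M x; rewrite /dotc !big_ord0 mulr0.
have [l lM lmin] := eigenvalue_le_rayleigh n0 MT.
suff -> : smallest_eigenvalue M = l by [].
have lle m : eigenvalue M m -> l <= m.
  move=> /(rayleigh_eigenvalue MT)[y y0 yM].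
  by rewrite -(ler_pM2r y0) -yM.
apply: get_unique => // m [mM mle].
by apply/eqP; rewrite eq_le lle// mle.
Qed.

(** Passing to [- M] turns the minimum of the Rayleigh quotient into a maximum. *)
Lemma greatest_eigenvalue_ge (R : realType) n (M : 'M[R]_n) (x : 'cV[R]_n) :
  M^T = M -> dotc x (M *m x) <= greatest_eigenvalue M * dotc x x.
Proof.
move=> MT; have [n0|n0] := posnP n.
  by move: M x {MT}; rewrite n0 => M x; rewrite /dotc !big_ord0 mulr0.
have NMT : (- M)^T = - M by rewrite linearN/= MT.
have dotN (y : 'cV[R]_n) : dotc y (- M *m y) = - dotc y (M *m y).
  by rewrite mulNmx -scaleN1r dotcZr mulN1r.
have [l /eigenvalueP[v vM v0] lmin] := eigenvalue_le_rayleigh n0 NMT.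
have lM : eigenvalue M (- l).
  by apply/eigenvalueP; exists v; rewrite // scaleNr -vM mulmxN opprK.
suff -> : greatest_eigenvalue M = - l.
  by rewrite mulNr lerNr -dotN.
have lge m : eigenvalue M m -> m <= - l.
  move=> /(rayleigh_eigenvalue MT)[y y0 yM].
  by rewrite -(ler_pM2r y0) -yM mulNr lerNr -dotN.
apply: get_unique => // m [mM mge].
by apply/eqP; rewrite eq_le lge// mge.
Qed.

(** The squared length of [A *m x] is the form of [A^T *m A] at [x], so the eigenvalue bound passes
    to square roots. *)
Lemma delta_min_le (R : realType) n (A : 'M[R]_n) (x : 'cV[R]_n) :
  delta_min A * enorm x <= enorm (A *m x).
Proof.
rewrite mulrC !enormE -sqrtrM ?dotc_ge0// ler_wsqrtr// mulrC.
rewrite -[leRHS]dotc_trmx dotcC mulmxA smallest_eigenvalue_le//.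
by rewrite trmx_mul trmxK.
Qed.

Lemma delta_max_ge (R : realType) n (A : 'M[R]_n) (x : 'cV[R]_n) :
  enorm (A *m x) <= delta_max A * enorm x.
Proof.
rewrite mulrC !enormE -sqrtrM ?dotc_ge0// ler_wsqrtr// mulrC.
rewrite -[leLHS]dotc_trmx dotcC mulmxA greatest_eigenvalue_ge//.
by rewrite trmx_mul trmxK.
Qed.

(** * The map [A *m x - F x] *)

Lemma C1_map_linearB (R : realType) n (A : 'M[R]_n)
    (F : 'cV[R]_n -> 'cV[R]_n) : C1_map F ->
  C1_map (fun x => A *m x - F x) /\
  forall x, jac (fun x => A *m x - F x) x = A - jac F x.
Proof.
move=> [dF jF].
have A_diff (x : 'cV[R]_n) :
    is_diff x (mulmx A) (mulmx A : 'cV[R]_n -> 'cV[R]_n).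
  apply: DiffDef; last by rewrite diff_lin//; exact: mulmx_continuous.
  by apply: linear_differentiable; exact: mulmx_continuous.
have G_diff x := is_diffB (A_diff x) (differentiableP (dF x)).
have jE x : jac (fun x => A *m x - F x) x = A - jac F x.
  have dE v : 'd (fun x => A *m x - F x) x v = A *m v - 'd F x v.
    by case: (G_diff x) => _ /(congr1 (fun h : _ -> _ => h v)).
  by apply/matrixP => i j; rewrite [LHS]mxE dE diff_jac -mulmxBl -colE mxE.
split; last exact: jE.
split=> [x|]; first by case: (G_diff x).
rewrite (_ : jac _ = fun x => A - jac F x); last exact/funext.
by move=> x; apply: (cvgB (F := nbhs x)); [exact: cvg_cst|exact: jF].
Qed.

(** The reverse triangle inequality, with [k] the gap between the growth constant and the singular
    value: [delta_min A - a] or [b - delta_max A]. *)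
Lemma enorm_linearB_ge (R : realType) n (A : 'M[R]_n)
    (F : 'cV[R]_n -> 'cV[R]_n) :
  (exists a : R, 0 < a < delta_min A /\
     exists r : R, forall x, r <= enorm x -> enorm (F x) <= a * enorm x) \/
  (exists b : R, delta_max A < b /\
     exists r : R, forall x, r <= enorm x -> b * enorm x <= enorm (F x)) ->
  exists2 k, 0 < k & exists r, forall x, r <= enorm x ->
    k * enorm x <= enorm (A *m x - F x).
Proof.
case=> [[a [/andP[_ aA] [r Fr]]]|[b [bA [r Fr]]]].
  exists (delta_min A - a); first by rewrite subr_gt0.
  exists r => x /Fr Fx; have := enormB (A *m x) (F x).
  by have := delta_min_le A x; lra.
exists (b - delta_max A); first by rewrite subr_gt0.
exists r => x /Fr Fx; have := enormB (F x) (A *m x).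
by rewrite -(enormN (F x - _)) opprB; have := delta_max_ge A x; lra.
Qed.

Theorem theorem4p1 (R : realType) (n : nat) (A : 'M[R]_n)
    (F : 'cV[R]_n -> 'cV[R]_n)
    (A_neq0 : A != 0)
    (F_C1 : C1_map F)
    (F_growth :
      (exists a : R, 0 < a < delta_min A /\
         exists r : R, forall x : 'cV[R]_n, r <= enorm x ->
           enorm (F x) <= a * enorm x)
      \/
      (exists b : R, delta_max A < b /\
         exists r : R, forall x : 'cV[R]_n, r <= enorm x ->
           b * enorm x <= enorm (F x)))
    (F_det : forall x : 'cV[R]_n, \det (A - jac F x) != 0) :
  forall xi : 'cV[R]_n, exists! x : 'cV[R]_n, A *m x = F x + xi.
Proof.
move=> xi; pose G x := A *m x - F x.
have [[dG jG] jE] := C1_map_linearB A F_C1.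
have Gunit z : jac G z \in unitmx by rewrite unitmxE unitfE jE.
have [k k0 [r Gk]] := enorm_linearB_ge F_growth.
have Gproper M : exists B, forall x, `|G x| <= M -> `|x| <= B.
  (* Either [enorm x <= r], or [k * enorm x <= enorm (G x) <= Num.sqrt n%:R * M]. *)
  exists (Num.max r (Num.sqrt n%:R * M / k)) => x GM.
  rewrite (le_trans (le_norm_enorm x))// le_max.
  have [//|/ltW /Gk kx] := leP (enorm x) r.
  rewrite ler_pdivlMr// mulrC (le_trans kx)// (le_trans (le_enorm_norm _))//.
  by rewrite ler_wpM2l// sqrtr_ge0.
have GE x : A *m x = F x + xi <-> G x = xi.
  by split=> [Ax|<-]; rewrite /G ?Ax addrC ?addKr ?subrK.
have [x Gx] := proper_surjective xi dG Gunit Gproper.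
exists x; split=> [|x' /GE Gx']; first exact/GE.
exact: (proper_injective dG jG Gunit Gproper (etrans Gx (esym Gx'))).
Qed.
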